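(* Let $d\ge 1$ and let $\{A_n^1\}_{n\ge0}$ be an arbitrary (not necessarily symmetric) sequence of monic type II multiple orthogonal polynomials with respect to $d$ linear functionals, satisfying a $(d+2)$-term recurrence relation, and let $J_1$ be the corresponding semi-infinite $(d+2)$-banded matrix. Suppose that $J_1$ has the (unique) $LU$ factorization $$J_1=LU=L_1L_2\cdots L_dU,$$ where $U$ is an upper two-banded, semi-infinite, invertible matrix, $L=L_1\cdots L_d$ is a $(d+1)$-banded lower triangular semi-infinite matrix with ones on the main diagonal, and each $L_i$, $i=1,\dots,d$, is a lower two-banded, semi-infinite, invertible matrix with ones on the main diagonal. Let $J_j$, $j=2,\dots,d+1$, be the Darboux transformations of $J_1$ given by the circular permutations of this product, $$J_2=L_2\cdots L_dUL_1,\quad J_3=L_3\cdots L_dUL_1L_2,\ \dots,\quad J_{d+1}=UL_1L_2\cdots L_d,$$ and let $\{A_n^j\}_{n\ge 0}$, $j=2,\dots,d+1$, be the $d$ families of monic type II multiple orthogonal polynomials satisfying the $(d+2)$-term recurrence relations given by the matrices $J_j$. Then the sequence $\{S_n\}_{n\ge 0}$ defined by $$S_{(d+1)n+j-1}(x)=x^{j-1}A_n^{j}(x^{d+1}),\qquad j=1,\dots,d+1,\ n\ge0,$$ is a $d$-symmetric sequence of type II multiple orthogonal polynomials.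
   Context: $\mathbb{P}$ is the space of polynomials with complex coefficients. Type II multiple orthogonality: diagonal multi-indices are the elements of $\mathcal{I}=\{(0,\dots,0),(1,0,\dots,0),\dots,(1,\dots,1),(2,1,\dots,1),\dots,(2,\dots,2),\dots\}\subset\mathbb{N}^d$; there is exactly one of each length $n=n_1+\dots+n_d$. A sequence of monic polynomials $\{P_n\}_{n\ge0}$ with $\deg P_n=n$ is type II multiple orthogonal (also called $d$-orthogonal) with respect to linear functionals $u^1,\dots,u^d:\mathbb{P}\to\mathbb{C}$ if for each $n$, with $(n_1,\dots,n_d)\in\mathcal{I}$ of length $n$, $u^j(x^kP_n)=0$ for $k=0,\dots,n_j-1$, $j=1,\dots,d$; the system $\{u^1,\dots,u^d\}$ is required to be regular, i.e. for each $n$ every nonzero polynomial of degree at most $n$ satisfying these conditions has degree exactly $n$. ''A sequence of type II multiple orthogonal polynomials'' means: with respect to some regular system of $d$ functionals. Such monic sequences are exactly those satisfying a $(d+2)$-term recurrence relation $$xP_{n+d}(x)=P_{n+d+1}(x)+\beta_{n+d}P_{n+d}(x)+\sum_{\nu=0}^{d-1}\gamma_{n+d-\nu}^{d-1-\nu}P_{n+d-1-\nu}(x),\quad \gamma^0_{n+1}\ne0,\ n\ge0,$$ with $P_0=1$, $P_1=x-\beta_0$, $P_n=(x-\beta_{n-1})P_{n-1}-\sum_{\nu=0}^{n-2}\gamma_{n-1-\nu}^{d-1-\nu}P_{n-2-\nu}$ for $2\le n\le d$. The $(d+2)$-banded matrix corresponding to $\{P_n\}$ is the semi-infinite lower Hessenberg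 matrix $J$ (ones on the first superdiagonal) with $x\,\underline{\mathbf{P}}=J\,\underline{\mathbf{P}}$, where $\underline{\mathbf{P}}=[P_0(x),P_1(x),P_2(x),\dots]^T$; conversely ''$\{A_n^j\}$ satisfies the recurrence given by $J_j$'' means $x\,\underline{\mathbf{A}}^j=J_j\,\underline{\mathbf{A}}^j$ with $\underline{\mathbf{A}}^j=[A_0^j(x),A_1^j(x),\dots]^T$ and $A_0^j=1$. A lower (upper) two-banded matrix is one whose entries vanish off the main diagonal and the first subdiagonal (superdiagonal), with all the entries on these two diagonals being nonzero. A monic sequence $\{S_n\}$ is $d$-symmetric if $S_n(\xi_kx)=\xi_k^nS_n(x)$ for all $n\ge0$ and $k=1,\dots,d$, where $\xi_k=\exp(2k\pi i/(d+1))$. *)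

(* Defs.v *)
From HB Require Import structures.
From mathcomp Require Import all_boot all_order all_algebra.
From mathcomp Require Import all_classical all_reals all_analysis.
From mathcomp Require Import complex.

Set Implicit Arguments.
Unset Strict Implicit.
Unset Printing Implicit Defensive.

Import Order.TTheory GRing.Theory Num.Theory.
Local Open Scope classical_set_scope.
Local Open Scope ring_scope.

Section SemiInfiniteMatrices.
Variable K : fieldType.

Definition semimx := nat -> nat -> K.

Definition semimx1 : semimx := fun i k => (i == k)%:R.

(* The sum over all natural numbers is finitely supported as soon as row i of
   A or column k of B is finite, which is the case in every product formed
   below; it is 0 by convention when the support is infinite. *)
Definition semimx_mul (A B : semimx) : semimx :=
  fun i k => \sum_(l \in [set: nat]) (A i l * B l k).

Definition semimx_mul_defined (A B : semimx) : Prop :=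
  forall i k, finite_set [set l | A i l * B l k != 0].

(* The inverse need not be row-finite (e.g. that of an upper two-banded
   matrix), hence the explicit requirement that both products make sense. *)
Definition semimx_invertible (A : semimx) : Prop :=
  exists B : semimx,
    [/\ semimx_mul_defined A B, semimx_mul_defined B A,
        semimx_mul A B = semimx1 & semimx_mul B A = semimx1].

Definition lower_two_banded (A : semimx) : Prop :=
  [/\ forall i k, i != k -> i != k.+1 -> A i k = 0,
      forall i, A i i != 0
    & forall i, A i.+1 i != 0].

Definition upper_two_banded (A : semimx) : Prop :=
  [/\ forall i k, i != k -> k != i.+1 -> A i k = 0,
      forall i, A i i != 0
    & forall i, A i i.+1 != 0].

Definition unit_diagonal (A : semimx) : Prop := forall i, A i i = 1.

(* Main diagonal and the first d subdiagonals. *)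
Definition lower_banded (d : nat) (A : semimx) : Prop :=
  forall i k, (i < k)%N || (k + d < i)%N -> A i k = 0.

End SemiInfiniteMatrices.

Notation "A ** B" := (semimx_mul A B)
  (at level 40, left associativity) : ring_scope.

(* Ordered (noncommutative) product over increasing indices. *)
Notation "\smprod_ ( i < n | P ) F" := (\big[@semimx_mul _/semimx1 _]_(i < n | P) F)
  (at level 36, F at level 36, i, n at level 50) : ring_scope.
Notation "\smprod_ ( i < n ) F" := (\big[@semimx_mul _/semimx1 _]_(i < n) F)
  (at level 36, F at level 36, i, n at level 50) : ring_scope.

(* Indices start at 0: the matrices written L_1, ..., L_d and
   J_1, ..., J_(d+1) in the literature are here L 0, ..., L (d-1) and
   darboux L U 0, ..., darboux L U d. *)
Definition darboux (K : fieldType) (d : nat) (L : 'I_d -> semimx K)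
    (U : semimx K) (j : nat) : semimx K :=
  (\smprod_(i < d | (j <= i)%N) L i) ** U ** (\smprod_(i < d | (i < j)%N) L i).

Section MultipleOrthogonality.
Variable K : fieldType.

(* Component j of the unique multi-index of length n in the chain
   (0,...,0), (1,0,...,0), ..., (1,...,1), (2,1,...,1), ... *)
Definition diag_index (d n : nat) (j : 'I_d) : nat :=
  (n %/ d + (j < n %% d))%N.

Definition multi_orthogonal (d : nat) (u : 'I_d -> {scalar {poly K}})
    (n : nat) (q : {poly K}) : Prop :=
  forall (j : 'I_d) (k : nat), (k < diag_index n j)%N -> u j ('X^k * q) = 0.

Definition regular_system (d : nat) (u : 'I_d -> {scalar {poly K}}) : Prop :=
  forall (n : nat) (q : {poly K}), q != 0 -> (size q <= n.+1)%N ->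
    multi_orthogonal u n q -> size q = n.+1.

Definition monic_sequence (P : nat -> {poly K}) : Prop :=
  forall n, (P n \is monic) /\ size (P n) = n.+1.

Definition typeII_mops (d : nat) (P : nat -> {poly K}) : Prop :=
  monic_sequence P /\
  exists u : 'I_d -> {scalar {poly K}},
    regular_system u /\ forall n, multi_orthogonal u n (P n).

(* x P = J P componentwise, with initial value P_0 = 1. *)
Definition satisfies_recurrence (J : semimx K) (P : nat -> {poly K}) : Prop :=
  P 0%N = 1 /\
  forall n, 'X * P n = \sum_(k \in [set: nat]) (J n k *: P k).

(* Matrices of (d+2)-term recurrences: the entries are
     J n n = beta_n and J n (n-1-nu) = gamma^(d-1-nu)_(n-nu) for nu < d,
   the lowest diagonal being gamma^0, which never vanishes. *)
Definition recurrence_matrix (d : nat) (J : semimx K) : Prop :=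
  [/\ forall n, J n n.+1 = 1,
      forall n k, (n.+1 < k)%N || (k + d < n)%N -> J n k = 0
    & forall n, J (n + d)%N n != 0].

End MultipleOrthogonality.

Section Symmetry.
Variable R : realType.
Local Open Scope complex_scope.

Definition cexp (z : R[i]) : R[i] :=
  (expR (complex.Re z))%:C * (cos (complex.Im z) +i* sin (complex.Im z)).

Definition xi (d k : nat) : R[i] :=
  cexp (0 +i* (2 * k%:R * pi / d.+1%:R)).

Definition d_symmetric (d : nat) (S : nat -> {poly R[i]}) : Prop :=
  forall n k : nat, (1 <= k <= d)%N ->
    forall x : R[i], (S n).[xi d k * x] = xi d k ^+ n * (S n).[x].

End Symmetry.

(* Main.v *)
Require Import Defs.
From HB Require Import structures.
From mathcomp Require Import all_boot all_order all_algebra.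
From mathcomp Require Import all_classical all_reals all_analysis.
From mathcomp Require Import complex.

(* Number the families A^0, ..., A^d and the factors L_0, ..., L_(d-1).  A unit
   lower Hessenberg matrix J determines the solution of x A = J A with A_0 = 1;
   since L_j ... L_(d-1) intertwines the last Darboux transform with the j-th
   one, A^j = L_j ... L_(d-1) A^d, that is A^j = L_j A^(j+1) and x A^d = U A^0.
   Read at x^(d+1), these bidiagonal relations are precisely the
   recurrence x S_(n+d) = S_(n+d+1) + g_n S_n, where the g_n are the nonzero
   subdiagonal entries of the L_j and diagonal entries of U.  Then let u^j be
   the j-th coordinate functional of the basis (S_n), j < d: in coordinates,
   multiplication by x either raises the index by one or lowers it by d with a
   nonzero factor, so u^j(x^k q), given that the coordinates of q of index
   less than j + k d vanish, is a nonzero multiple of the coordinate of index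
   j + k d.  The conditions of length n thus say that the first n coordinates
   of q vanish, which gives both orthogonality and regularity. *)

Set Implicit Arguments.
Unset Strict Implicit.
Unset Printing Implicit Defensive.

Import Order.TTheory GRing.Theory Num.Theory.
Local Open Scope classical_set_scope.
Local Open Scope ring_scope.

(** * Finite sums, and the action of semi-infinite matrices on sequences of polynomials *)

Lemma fsbig_nat_trunc (V : nmodType) (N : nat) (F : nat -> V) :
  (forall l, (N <= l)%N -> F l = 0) ->
  \sum_(l \in [set: nat]) F l = \sum_(l < N) F l.
Proof.
move=> F0; rewrite fsbig_ord; apply/esym/fsbig_widen => // l [_ /= /negP].
by rewrite -leqNgt => /F0.
Qed.

Section Action.
Variable K : fieldType.
Implicit Types (A B M : semimx K) (P Q : nat -> {poly K}).

(** Bounding rows on the right makes them finite, hence products and actions finite sums. Unit lower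
    triangular matrices have [b = 0]; [U] and the unit Hessenberg matrices have [b = 1]. *)
Definition unit_upper_band (b : nat) M : Prop :=
  (forall i k, (i + b < k)%N -> M i k = 0) /\ (forall i, M i (i + b)%N = 1).

Definition semimx_act M P : nat -> {poly K} :=
  fun n => \sum_(k \in [set: nat]) (M n k *: P k).

Lemma semimx_mul_trunc A B i k N :
  (forall l, (N <= l)%N -> A i l = 0) ->
  (A ** B) i k = \sum_(l < N) A i l * B l k.
Proof. by move=> A0; apply: fsbig_nat_trunc => l /A0 ->; rewrite mul0r. Qed.

Lemma semimx_act_trunc M P n N :
  (forall k, (N <= k)%N -> M n k = 0) ->
  semimx_act M P n = \sum_(k < N) M n k *: P k.
Proof. by move=> M0; apply: fsbig_nat_trunc => l /M0 ->; rewrite scale0r. Qed.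

Lemma unit_upper_band1 : unit_upper_band 0 (semimx1 K).
Proof.
split=> i; last by rewrite addn0 /semimx1 eqxx.
by move=> k; rewrite addn0 /semimx1 => /ltn_eqF ->.
Qed.

Lemma unit_upper_band_mul a b A B :
  unit_upper_band a A -> unit_upper_band b B -> unit_upper_band (a + b) (A ** B).
Proof.
move=> [A0 A1] [B0 B1]; split=> i.
  move=> k ltk; rewrite (semimx_mul_trunc _ _ (N := (i + a).+1)); last exact: A0.
  apply: big1 => l _; rewrite B0 ?mulr0 //; apply: leq_ltn_trans ltk.
  by rewrite addnA leq_add2r -ltnS.
rewrite (semimx_mul_trunc _ _ (N := (i + a).+1)); last exact: A0.
rewrite big_ord_recr /= A1 addnA B1 mulr1 big1 ?add0r // => l _.
by rewrite B0 ?mulr0 // ltn_add2r.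
Qed.

Lemma semimx_act_mul a b A B P :
  unit_upper_band a A -> unit_upper_band b B ->
  semimx_act (A ** B) P = semimx_act A (semimx_act B P).
Proof.
move=> hA hB; have [AB0 _] := unit_upper_band_mul hA hB.
have [A0 _] := hA; have [B0 _] := hB.
apply/funext => n.
rewrite (semimx_act_trunc _ (N := (n + (a + b)).+1)); last exact: AB0.
rewrite (semimx_act_trunc _ (N := (n + a).+1)); last exact: A0.
transitivity (\sum_(k < (n + (a + b)).+1) \sum_(l < (n + a).+1)
    A n l *: (B l k *: P k)).
  apply: eq_bigr => k _.
  rewrite (semimx_mul_trunc _ _ (N := (n + a).+1)) ?scaler_suml; last exact: A0.
  by apply: eq_bigr => l _; rewrite scalerA.
rewrite exchange_big; apply: eq_bigr => l _ /=; rewrite -scaler_sumr.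
congr (_ *: _); rewrite -semimx_act_trunc // => k ltk; apply: B0.
by apply: leq_trans ltk; rewrite addnA ltnS leq_add2r -ltnS.
Qed.

Lemma semimx_act1 P : semimx_act (semimx1 K) P = P.
Proof.
apply/funext => n; rewrite (semimx_act_trunc _ (N := n.+1)) => [|k ltk].
  rewrite big_ord_recr /= big1 => [|k _].
    by rewrite add0r /semimx1 eqxx scale1r.
  by rewrite /semimx1 gtn_eqF // scale0r.
by rewrite /semimx1 ltn_eqF.
Qed.

Lemma semimx_mulr1 b M : unit_upper_band b M -> M ** semimx1 K = M.
Proof.
move=> [M0 _]; apply/funext => i; apply/funext => k.
(* The bound must exceed [k] too, so that the one surviving term is in the range. *)
have leN : (i + b < (i + b + k).+1)%N by rewrite ltnS leq_addr.
have ltk : (k < (i + b + k).+1)%N by rewrite ltnS leq_addl.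
rewrite (semimx_mul_trunc _ _ (N := (i + b + k).+1)); last first.
  by move=> l /(leq_trans leN); apply: M0.
rewrite (bigD1 (Ordinal ltk)) //= /semimx1 eqxx mulr1 big1 ?addr0 // => l.
by rewrite -val_eqE /= => /negPf ->; rewrite mulr0.
Qed.

Lemma semimx_act_mulX b M P :
  unit_upper_band b M ->
  semimx_act M (fun n => 'X * P n) = fun n => 'X * semimx_act M P n.
Proof.
move=> [M0 _]; apply/funext => n.
rewrite !(semimx_act_trunc _ (N := (n + b).+1)); try exact: M0.
by rewrite mulr_sumr; apply: eq_bigr => k _; rewrite scalerAr.
Qed.

Lemma semimx_act_at0 M P :
  unit_upper_band 0 M -> semimx_act M P 0 = P 0.
Proof.
move=> [M0 M1]; rewrite (semimx_act_trunc _ (N := 1)) => [|k ltk]; last exact: M0.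
by rewrite big_ord1 (M1 0) scale1r.
Qed.

(** The entry 1 at [(n, n.+1)] lets row [n] be solved for the polynomial of index [n.+1]. *)
Lemma hessenberg_recurrence_unique J P Q : unit_upper_band 1 J ->
  satisfies_recurrence J P -> satisfies_recurrence J Q -> P = Q.
Proof.
move=> [J0 J1] [P0 PX] [Q0 QX]; apply/funext => n.
elim/ltn_ind: n => -[|n] IHn; first by rewrite P0 Q0.
have step T : (forall m, 'X * T m = semimx_act J T m) ->
    T n.+1 = 'X * T n - \sum_(k < n.+1) J n k *: T k.
  move=> ->; rewrite (semimx_act_trunc _ (N := n.+2)) => [|k ltk].
    have Jn : J n n.+1 = 1 by rewrite -(J1 n) addn1.
    by rewrite big_ord_recr /= Jn scale1r addrAC subrr add0r.
  by apply: J0; rewrite addn1.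
rewrite (step P) // (step Q) // IHn //; congr (_ - _).
by apply: eq_bigr => k _; rewrite IHn.
Qed.

Lemma lower_two_banded_unit_upper M :
  lower_two_banded M -> unit_diagonal M -> unit_upper_band 0 M.
Proof.
move=> [M0 _ _] M1; split=> i; last by rewrite addn0.
move=> k; rewrite addn0 => ltik; apply: M0; first by rewrite ltn_eqF.
by rewrite ltn_eqF // ltnS ltnW.
Qed.

Lemma semimx_act_lower_two_banded M P n :
  lower_two_banded M -> unit_diagonal M ->
  semimx_act M P n.+1 = P n.+1 + M n.+1 n *: P n.
Proof.
move=> hM M1; have [+ _] := lower_two_banded_unit_upper hM M1.
have [M0 _ _] := hM => Mu.
rewrite (semimx_act_trunc _ (N := n.+2)) => [|k ltk]; last first.
  by apply: Mu; rewrite addn0.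
rewrite !big_ord_recr /= M1 scale1r big1 ?add0r => [|k _]; first exact: addrC.
by rewrite M0 ?scale0r ?eqSS ?gtn_eqF // ltnS ltnW.
Qed.

Lemma semimx_act_upper_two_banded M P n :
  upper_two_banded M -> unit_upper_band 1 M ->
  semimx_act M P n = P n.+1 + M n n *: P n.
Proof.
move=> [M0 _ _] [Mu M1].
rewrite (semimx_act_trunc _ (N := n.+2)) => [|k ltk]; last first.
  by apply: Mu; rewrite addn1.
have Mn : M n n.+1 = 1 by rewrite -(M1 n) addn1.
rewrite !big_ord_recr /= Mn scale1r big1 ?add0r; last first.
  move=> k _; have ltkn := ltn_ord k.
  by rewrite M0 ?scale0r ?[n == _ :> nat]gtn_eqF // ltn_eqF // ltnS ltnW.
exact: addrC.
Qed.

Lemma unit_upper_band_smprod (d : nat) (p : pred 'I_d) (L : 'I_d -> semimx K) :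
  (forall i, unit_upper_band 0 (L i)) ->
  unit_upper_band 0 (\smprod_(i < d | p i) L i).
Proof.
move=> hL; apply: (big_ind (unit_upper_band 0)) => // [|A B].
  exact: unit_upper_band1.
exact: (@unit_upper_band_mul 0 0).
Qed.

End Action.

(** * Darboux transformations and the bidiagonal relations between consecutive families *)

Section Darboux.
Variables (K : fieldType) (d : nat) (L : 'I_d.+1 -> semimx K) (U : semimx K).
Hypothesis hL : forall i, unit_upper_band 0 (L i).
Hypothesis hU : unit_upper_band 1 U.

(** The product of semi-infinite matrices is not associative in general, whereas composition of
    actions is a monoid law, so that iterated products can be split. *)
Definition act_comp (f g : (nat -> {poly K}) -> (nat -> {poly K})) := f \o g.

Lemma act_compA : associative act_comp. Proof. by []. Qed.
Lemma act_comp1l : left_id idfun act_comp. Proof. by []. Qed.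
Lemma act_comp1r : right_id idfun act_comp. Proof. by []. Qed.

HB.instance Definition _ :=
  Monoid.isLaw.Build _ idfun act_comp act_compA act_comp1l act_comp1r.

Let F (k : nat) := semimx_act (L (inord k)).

Lemma semimx_act_smprod (p : pred nat) :
  semimx_act (\smprod_(i < d.+1 | p i) L i) =
  \big[act_comp/idfun]_(i < d.+1 | p i) F i.
Proof.
pose R (M : semimx K) f := semimx_act M = f /\ unit_upper_band 0 M.
suff [] : R (\smprod_(i < d.+1 | p i) L i)
  (\big[act_comp/idfun]_(i < d.+1 | p i) F i) by [].
apply: (big_ind2 R) => [|A f B g [<- hA] [<- hB]|i _].
- by split; [apply/funext => P; rewrite semimx_act1 | exact: unit_upper_band1].
- split; last exact: (unit_upper_band_mul hA hB).
  by apply/funext => P; rewrite (semimx_act_mul _ hA hB).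
- by split => //; rewrite /F inord_val.
Qed.

Let upper j := semimx_act (\smprod_(i < d.+1 | (j <= i)%N) L i).
Let lower j := semimx_act (\smprod_(i < d.+1 | (i < j)%N) L i).

Lemma upperE j : upper j = \big[act_comp/idfun]_(j <= i < d.+1) F i.
Proof. by rewrite /upper (semimx_act_smprod (leq j)) big_geq_mkord. Qed.

Lemma lowerE j : (j <= d.+1)%N ->
  lower j = \big[act_comp/idfun]_(0 <= i < j) F i.
Proof.
move=> lej; rewrite /lower (semimx_act_smprod (fun i => (i < j)%N)) big_mkord.
by rewrite (big_ord_widen_cond d.+1 xpredT).
Qed.

Lemma semimx_act_darboux j P :
  semimx_act (darboux L U j) P = upper j (semimx_act U (lower j P)).
Proof.
have hp p := unit_upper_band_smprod p hL.
rewrite /darboux (semimx_act_mul _ (unit_upper_band_mul (hp _) hU) (hp _)).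
by rewrite (semimx_act_mul _ (hp _) hU).
Qed.

Lemma unit_upper_band_darboux j : unit_upper_band 1 (darboux L U j).
Proof.
have hp p := unit_upper_band_smprod p hL.
exact: (unit_upper_band_mul (unit_upper_band_mul (hp _) hU) (hp _)).
Qed.

Variable A : 'I_d.+2 -> nat -> {poly K}.
Hypothesis hA : forall j : 'I_d.+2, satisfies_recurrence (darboux L U j) (A j).

Lemma darboux_last : semimx_act U (lower d.+1 (A ord_max)) =
  fun n => 'X * A ord_max n.
Proof.
have [_ /(_ _)/esym AX] := hA ord_max.
have {AX} : semimx_act (darboux L U d.+1) (A ord_max)
  = fun n => 'X * A ord_max n by apply/funext.
by rewrite semimx_act_darboux upperE big_geq.
Qed.

(** Put M = L_j ... L_d and N = L_0 ... L_(j-1). Then (M U N) M = M (U N M), so M applied to the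
    last family solves the recurrence of index [j], and it starts with 1. *)
Lemma darboux_upper (j : 'I_d.+2) : A j = upper j (A ord_max).
Proof.
apply: (hessenberg_recurrence_unique (unit_upper_band_darboux j) (hA j)).
have hp p := unit_upper_band_smprod p hL.
split; first by rewrite [LHS]semimx_act_at0 //; case: (hA ord_max).
move=> n.
suff -> : \sum_(k \in [set: nat]) darboux L U j n k *: upper j (A ord_max) k =
    upper j (fun m => 'X * A ord_max m) n.
  by rewrite /upper (semimx_act_mulX _ (hp _)).
rewrite -[LHS]/(semimx_act (darboux L U j) (upper j (A ord_max)) n).
rewrite semimx_act_darboux -darboux_last; congr (upper j (semimx_act U _) n).
have lej : (j <= d.+1)%N by rewrite -ltnS.
rewrite upperE !lowerE //.
by rewrite [in RHS](big_cat_nat _ (n := j)).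
Qed.

Lemma darboux_step (j : 'I_d.+1) :
  A (widen_ord (leqnSn _) j) = semimx_act (L j) (A (lift ord0 j)).
Proof.
rewrite (darboux_upper (widen_ord _ _)) (darboux_upper (lift _ _)) !upperE.
rewrite big_ltn /=; last exact: ltn_ord.
by rewrite /F inord_val.
Qed.

Lemma darboux_cycle : (fun n => 'X * A ord_max n) = semimx_act U (A ord0).
Proof. by rewrite -darboux_last (darboux_upper ord0) upperE lowerE. Qed.

End Darboux.

(** * A Favard theorem for the recurrence x P_(n+d) = P_(n+d+1) + g_n P_n *)

Section Favard.
Variables (K : fieldType) (d : nat) (g : nat -> K).
Implicit Types (q : {poly K}) (k l n : nat).

Hypothesis d_gt0 : (0 < d)%N.

(* Row [k] will hold the coordinates of ['X^k] in the basis [P], when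
   [P n.+1 = 'X * P n] for [n < d] and
   [P (n + d).+1 = 'X * P (n + d) - g n *: P n]. *)
Fixpoint moment (k l : nat) : K :=
  if k is k'.+1
  then (if l is l'.+1 then moment k' l' else 0) + g l * moment k' (l + d)
  else (l == 0)%:R.

(** The coordinate of [q] of index [l] in the basis [P], built from [g] alone; [dual_coord_basis]
    justifies this reading. *)
Definition dual_coord (l : nat) (q : {poly K}) : K :=
  \sum_(k < size q) q`_k * moment k l.

Lemma dual_coord_trunc N l q : (size q <= N)%N ->
  dual_coord l q = \sum_(k < N) q`_k * moment k l.
Proof.
move=> leN; rewrite /dual_coord (big_ord_widen N (fun k => q`_k * moment k l)) //.
rewrite big_mkcond; apply: eq_bigr => k _; case: ltnP => // /(nth_default 0) ->.
by rewrite mul0r.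
Qed.

Lemma dual_coord_linear l : linear_for *%R (dual_coord l).
Proof.
move=> a p q; set N := maxn (size p) (size q).
have leN : (size (a *: p + q)%R <= N)%N.
  apply: leq_trans (size_polyD _ _) _.
  by rewrite geq_max leq_max leq_maxr size_scale_leq.
rewrite (dual_coord_trunc _ leN).
rewrite (@dual_coord_trunc N _ p) ?leq_maxl // (@dual_coord_trunc N _ q) ?leq_maxr //.
rewrite mulr_sumr -big_split; apply: eq_bigr => k _ /=.
by rewrite coefD coefZ mulrDl mulrA.
Qed.

HB.instance Definition _ l :=
  GRing.isLinear.Build K {poly K} K *%R (dual_coord l) (dual_coord_linear l).

(** In the basis, x P_m has a component along P_l only for m = l - 1, with factor 1, and for m = l +
    d, with factor g_l. *)
Lemma dual_coordXM l q :
  dual_coord l ('X * q) =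
  (if l is l'.+1 then dual_coord l' q else 0) + g l * dual_coord (l + d) q.
Proof.
have leX : (size ('X * q)%R <= (size q).+1)%N.
  have [->|q0] := eqVneq q 0; first by rewrite mulr0 size_poly0.
  by rewrite mulrC size_mulX.
rewrite (dual_coord_trunc _ leX) big_ord_recl coefXM mul0r add0r.
under eq_bigr do rewrite coefXM /= mulrDr.
rewrite big_split; congr (_ + _) => /=; last first.
  by rewrite mulr_sumr; apply: eq_bigr => k _; rewrite mulrCA.
case: l => [|l] //; by apply: big1 => k _; rewrite mulr0.
Qed.

(** Each multiplication by x raises the index by at most one. *)
Lemma moment_upper k l : (k < l)%N -> moment k l = 0.
Proof.
elim: k l => [|k IHk] [|l] //= ltkl.
by rewrite !IHk ?mulr0 ?addr0 // ltn_addr // ltnW.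
Qed.

Lemma moment_diag k : moment k k = 1.
Proof.
elim: k => //= k ->; rewrite moment_upper ?mulr0 ?addr0 //.
by rewrite addSn ltnS leq_addr.
Qed.

Lemma dual_coord_inj n q : (size q <= n)%N ->
  (forall l, (l < n)%N -> dual_coord l q = 0) -> q = 0.
Proof.
elim: n => [|n IHn] leq q0; first by apply/eqP; rewrite -size_poly_leq0.
apply: IHn => [|l ltl]; last exact/q0/ltnW.
apply/leq_sizeP => j; rewrite leq_eqVlt => /predU1P[<-|]; last first.
  by move/leq_sizeP: leq => h ltj; apply: h.
(* By unitriangularity, the coordinate of index [n] is the coefficient of ['X^n]. *)
have := q0 n (ltnSn n); rewrite (dual_coord_trunc _ leq) big_ord_recr /=.
rewrite moment_diag mulr1 big1 ?add0r // => k _.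
by rewrite moment_upper ?mulr0.
Qed.

Hypothesis g_neq0 : forall n, g n != 0.

Lemma dual_coordXnM k j q :
  (forall l, (l < j + k * d)%N -> dual_coord l q = 0) ->
  (dual_coord j ('X^k * q) == 0) = (dual_coord (j + k * d) q == 0).
Proof.
elim: k j => [|k IHk] j q0; first by rewrite expr0 mul1r mul0n addn0.
rewrite exprS -mulrA dual_coordXM.
(* This term sees only coordinates of [q] up to index j - 1 + k d, which vanish. *)
have -> : (if j is j'.+1 then dual_coord j' ('X^k * q) else 0) = 0.
  case: j q0 => [//|j] q0; apply/eqP.
  have ltj : (j + k * d < j.+1 + k.+1 * d)%N.
    by rewrite addSn ltnS leq_add2l leq_mul2r leqnSn orbT.
  by rewrite IHk ?q0 // => l ltl; apply: q0; apply: ltn_trans ltj.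
rewrite add0r mulf_eq0 (negPf (g_neq0 j)) /= IHk -?addnA -?mulSn //.
Qed.

Let u (j : 'I_d) : {scalar {poly K}} := dual_coord j.

(** The numbers below [n] congruent to j modulo d are j, j + d, j + 2d, ..., and [diag_index n j] is
    how many there are. *)
Lemma diag_indexP n (j : 'I_d) k :
  (k < diag_index n j)%N = (j + k * d < n)%N.
Proof.
rewrite /diag_index {3}(divn_eq n d).
have := ltn_pmod n d_gt0; move: (n %/ d)%N (n %% d)%N => a r ltr.
have ltj := ltn_ord j.
have [ltka|ltak|->] := ltngtP k a; last 1 first.
- by rewrite (addnC (j : nat)) ltn_add2l -{1}[a]addn0 ltn_add2l lt0b.
- rewrite ltn_addr //; apply/esym.
  apply: (@leq_trans (k.+1 * d)); first by rewrite mulSn ltn_add2r.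
  by rewrite (leq_trans _ (leq_addr _ _)) // leq_mul2r ltka orbT.
apply/idP/idP; apply: contraTT => _; rewrite -leqNgt.
  by apply: leq_trans ltak; rewrite -[a.+1]addn1 leq_add2l leq_b1.
apply: (@leq_trans (a.+1 * d)).
  by rewrite mulSn addnC leq_add2r ltnW.
by rewrite (leq_trans _ (leq_addl _ _)) // leq_mul2r ltak orbT.
Qed.

Lemma multi_orthogonal_dual n q :
  multi_orthogonal u n q <-> forall l, (l < n)%N -> dual_coord l q = 0.
Proof.
split=> [uq l|q0 j k]; last first.
  rewrite diag_indexP => ltn; apply/eqP.
  rewrite [_ == 0]dual_coordXnM ?q0 // => l ltl; apply: q0.
  exact: ltn_trans ltn.
elim/ltn_ind: l => l IHl ltln.
(* Since l = (l mod d) + (l / d) d, the functional of index l mod d, tested against the power l / d,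
   isolates coordinate [l]. *)
have ltm := ltn_pmod l d_gt0; have El := divn_eq l d; rewrite addnC in El.
have := uq (Ordinal ltm) (l %/ d)%N; rewrite diag_indexP /= -El => /(_ ltln)/eqP.
rewrite [_ == 0]dual_coordXnM -El => [/eqP //|l' ltl'].
by apply: IHl => //; apply: ltn_trans ltln.
Qed.

Lemma regular_system_dual : regular_system u.
Proof.
move=> n q q0 leq /multi_orthogonal_dual qn.
apply/eqP; rewrite eqn_leq leq ltnNge; apply/negP => {}leq.
by move/eqP: q0; apply; apply: dual_coord_inj qn.
Qed.

Variable P : nat -> {poly K}.
Hypothesis P_init : forall n, (n <= d)%N -> P n = 'X^n.
Hypothesis P_step : forall n, P (n + d).+1 = 'X * P (n + d)%N - g n *: P n.

Lemma monic_sequence_rec : monic_sequence P.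
Proof.
move=> n; elim/ltn_ind: n => n IHn; have [len|ltn] := leqP n d.
  by rewrite P_init // monicXn size_polyXn.
case: n ltn IHn => // n; rewrite ltnS => len; rewrite -(subnK len).
move: (n - d)%N => {len} {}n IHn; rewrite P_step.
have [mX sX] := IHn (n + d)%N (ltnSn _).
have [_ sn] := IHn n (leq_addr _ _).
have sXP : size ('X * P (n + d)%N) = (n + d).+2.
  by rewrite mulrC size_mulX ?sX // monic_neq0.
have lt : (size (- (g n *: P n))%R < size ('X * P (n + d)%N)%R)%N.
  rewrite size_polyN sXP (leq_ltn_trans (size_scale_leq _ _)) // sn.
  by rewrite !ltnS leq_addr.
rewrite size_polyDl // sXP; split=> //; rewrite monicE lead_coefDl //.
by rewrite -monicE monicMl ?monicX.
Qed.

Lemma dual_coord_basis n l : dual_coord l (P n) = (n == l)%:R.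
Proof.
elim/ltn_ind: n l => n IHn l; have [len|ltn] := leqP n d.
  rewrite P_init //; case: n len IHn => [_ _|n ltnd IHn].
    by rewrite (@dual_coord_trunc 1) ?size_poly1 // big_ord1 coef1 mul1r eq_sym.
  have Pn := P_init (ltnW ltnd); rewrite exprS dual_coordXM -Pn !IHn //.
  (* No lowering term yet: n < d <= l + d. *)
  rewrite [n == _]ltn_eqF ?mulr0 ?addr0; last by rewrite ltn_addl.
  by case: l => [|l]; rewrite ?IHn.
case: n ltn IHn => // n; rewrite ltnS => len; rewrite -(subnK len).
move: (n - d)%N => {len} {}n IHn; rewrite P_step linearB linearZ /= dual_coordXM.
rewrite !IHn ?ltnS ?leq_addr // eqn_add2r.
(* The lowering term of ['X * P (n + d)] cancels the subtracted multiple of [P n]; only the shift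
   remains. *)
have -> : g l * (n == l)%:R = g n * (n == l)%:R.
  by case: eqP => [->|_]; rewrite ?mulr0.
by rewrite addrK; case: l => [|l]; rewrite ?IHn.
Qed.

Lemma typeII_mops_rec : typeII_mops d P.
Proof.
split; first exact: monic_sequence_rec.
exists u; split; first exact: regular_system_dual.
move=> n; apply/multi_orthogonal_dual => l ltl.
by rewrite dual_coord_basis gtn_eqF.
Qed.

End Favard.

(** * The symmetrized sequence and its recurrence *)

Section Symmetrization.
Variables (K : fieldType) (d : nat) (L : 'I_d.+1 -> semimx K) (U : semimx K).
Hypothesis L_banded : forall i, lower_two_banded (L i).
Hypothesis L_unit : forall i, unit_diagonal (L i).
Hypothesis U_banded : upper_two_banded U.
Hypothesis U_band1 : unit_upper_band 1 U.
Variable A : 'I_d.+2 -> nat -> {poly K}.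
Hypothesis hA : forall j : 'I_d.+2, satisfies_recurrence (darboux L U j) (A j).
Variable S : nat -> {poly K}.
Hypothesis S_def : forall (n : nat) (j : 'I_d.+2),
  S (d.+2 * n + j)%N = 'X^j * (A j n \Po 'X^(d.+2)).

Let hL i : unit_upper_band 0 (L i) :=
  lower_two_banded_unit_upper (L_banded i) (L_unit i).

(* In [S (n + d.+1).+1 = 'X * S (n + d.+1) - symm_coef n *: S n], the index
   [n + d.+1] has residue [d.+1] modulo [d.+2] when that of [n] is [0], and
   residue one less than that of [n] otherwise. *)
Definition symm_coef (n : nat) : K :=
  let q := (n %/ d.+2)%N in
  if (n %% d.+2)%N is i.+1 then L (inord i) q.+1 q else U q q.

Lemma symm_coef_neq0 n : symm_coef n != 0.
Proof.
have [_ U0 _] := U_banded.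
by rewrite /symm_coef; case: (n %% _)%N => // i; case: (L_banded (inord i)).
Qed.

Lemma symm_init n : (n <= d.+1)%N -> S n = 'X^n.
Proof.
move=> len; have := S_def 0 (Ordinal (len : (n < d.+2)%N)).
rewrite muln0 add0n => ->.
by have [-> _] := hA (Ordinal (len : (n < d.+2)%N)); rewrite -polyC1 comp_polyC mulr1.
Qed.

Lemma symm_step n :
  S (n + d.+1).+1 = 'X * S (n + d.+1)%N - symm_coef n *: S n.
Proof.
rewrite /symm_coef; have := ltn_pmod n (ltn0Sn d.+1); have := divn_eq n d.+2.
move: (n %/ _)%N (n %% _)%N => q [|i] -> => [_|].
  have -> : (q * d.+2 + 0 + d.+1).+1 = (d.+2 * q.+1 + (ord0 : 'I_d.+2))%N.
    by rewrite !addn0 -addnS mulnC mulnS addnC.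
  have -> : (q * d.+2 + 0 + d.+1)%N = (d.+2 * q + (ord_max : 'I_d.+2))%N.
    by rewrite addn0 mulnC.
  have -> : (q * d.+2 + 0)%N = (d.+2 * q + (ord0 : 'I_d.+2))%N.
    by rewrite mulnC.
  rewrite !S_def expr0 !mul1r /=.
  (* Row [q] of x A^(d+1) = U A^0, read at x^(d+2). *)
  have := congr1 (fun f => f q) (darboux_cycle hL U_band1 hA).
  rewrite semimx_act_upper_two_banded // => /(congr1 (comp_poly 'X^(d.+2))).
  rewrite comp_polyM comp_polyX comp_polyD comp_polyZ => E.
  by rewrite mulrA -exprS E addrK.
rewrite ltnS => lti.
have Ei : (inord i : 'I_d.+1) = Ordinal lti by apply/val_inj; rewrite /= inordK.
(* Row [q.+1] of A^i = L_i A^(i+1), read at x^(d+2) and multiplied by x^(i+1). *)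
rewrite Ei; set j := Ordinal lti.
have -> : (q * d.+2 + i.+1 + d.+1).+1 = (d.+2 * q.+1 + lift ord0 j)%N.
  by rewrite -addnS addnAC -mulSnr mulnC.
have -> : (q * d.+2 + i.+1 + d.+1)%N = (d.+2 * q.+1 + widen_ord (leqnSn _) j)%N.
  by rewrite -addnA addSnnS addnCA addnC -mulSnr mulnC.
have -> : (q * d.+2 + i.+1)%N = (d.+2 * q + lift ord0 j)%N by rewrite mulnC.
rewrite !S_def (darboux_step hL U_band1 hA) semimx_act_lower_two_banded //.
rewrite comp_polyD comp_polyZ /= /bump /= add1n mulrA -exprS mulrDr.
by rewrite -scalerAr addrK.
Qed.

Lemma typeII_mops_symm : typeII_mops d.+1 S.
Proof.
exact: (typeII_mops_rec (ltn0Sn d) symm_coef_neq0 symm_init symm_step).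
Qed.

End Symmetrization.

(** * Roots of unity and d-symmetry *)

Section RootsOfUnity.
Variable R : realType.
Local Open Scope complex_scope.

Lemma cexp_imaginaryX (t : R) n :
  cexp (0 +i* t) ^+ n = cos (t *+ n) +i* sin (t *+ n).
Proof.
rewrite /cexp /= expR0 mul1r; elim: n => [|n IHn].
  by rewrite expr0 mulr0n cos0 sin0.
rewrite exprSr IHn mulrSr cosD sinD; apply/eqP; rewrite eq_complex /=.
by rewrite !eqxx /= addrC.
Qed.

Lemma xi_root_unity d k : xi R d k ^+ d.+1 = 1.
Proof.
have full_turns : (2 * k%:R * pi / d.+1%:R) *+ d.+1 = 0 + pi *+ 2 *+ k :> R.
  rewrite -[LHS]mulr_natr divfK ?pnatr_eq0 // add0r -mulrnA -[RHS]mulr_natl.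
  by rewrite natrM.
rewrite /xi cexp_imaginaryX full_turns.
by rewrite (periodicn (@cosD2pi R)) (periodicn (@sinD2pi R)) cos0 sin0.
Qed.

(** Each S_n is x^j times a polynomial in x^(d+1), with j = n mod (d+1); a (d+1)-th root of unity
    leaves the second factor unchanged. *)
Lemma d_symmetric_symm (d : nat) (A : 'I_d.+1 -> nat -> {poly R[i]})
    (S : nat -> {poly R[i]}) :
  (forall (n : nat) (j : 'I_d.+1),
    S (d.+1 * n + j)%N = 'X^j * (A j n \Po 'X^(d.+1))) ->
  d_symmetric d S.
Proof.
move=> S_def n k _ x; rewrite (divn_eq n d.+1) (mulnC _ d.+1).
rewrite (S_def _ (Ordinal (ltn_pmod n (ltn0Sn d)))) /=.
rewrite !hornerM !horner_comp !hornerXn.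
move: (xi R d k) (xi_root_unity d k) => z z1.
by rewrite !exprMn z1 mul1r exprD exprM z1 expr1n mul1r mulrA.
Qed.

End RootsOfUnity.

Theorem theorem3 (R : realType) (d : nat) (d_ge1 : (1 <= d)%N)
    (A : 'I_d.+1 -> nat -> {poly R[i]})
    (J1 Lm U : semimx R[i]) (L : 'I_d -> semimx R[i])
    (* A^1 and its (d+2)-banded matrix J_1 *)
    (A1_mops : typeII_mops d (A ord0))
    (J1_banded : recurrence_matrix d J1)
    (A1_rec : satisfies_recurrence J1 (A ord0))
    (* J_1 = L U = L_1 ... L_d U *)
    (J1_LU : J1 = Lm ** U)
    (Lm_prod : Lm = \smprod_(i < d) L i)
    (U_banded : upper_two_banded U)
    (U_inv : semimx_invertible U)
    (Lm_banded : lower_banded d Lm)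
    (Lm_unit : unit_diagonal Lm)
    (L_banded : forall i, lower_two_banded (L i))
    (L_unit : forall i, unit_diagonal (L i))
    (L_inv : forall i, semimx_invertible (L i))
    (* A^2, ..., A^(d+1) and the Darboux transformations J_2, ..., J_(d+1) *)
    (A_rec : forall j : 'I_d.+1, (0 < j)%N ->
       satisfies_recurrence (darboux L U j) (A j))
    (S : nat -> {poly R[i]})
    (S_def : forall (n : nat) (j : 'I_d.+1),
       S (d.+1 * n + j)%N = 'X^j * (A j n \Po 'X^(d.+1))) :
  d_symmetric d S /\ typeII_mops d S.
Proof.
have hL i := lower_two_banded_unit_upper (L_banded i) (L_unit i).
have [Lm0 _] : unit_upper_band 0 Lm.
  by rewrite Lm_prod; apply: (unit_upper_band_smprod xpredT).
(* Row [i] of [Lm] ends with the diagonal entry 1 and column [i.+1] of [U] starts at row [i], so the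
   superdiagonal of [U] is that of [J1]. *)
have U_band1 : unit_upper_band 1 U.
  have [U0 _ _] := U_banded; split=> i; last first.
    have [/(_ i) J1i _ _] := J1_banded; rewrite addn1.
    move: J1i; rewrite J1_LU (semimx_mul_trunc _ _ (N := i.+1)); last first.
      by move=> l ltl; apply: Lm0; rewrite addn0.
    rewrite big_ord_recr /= Lm_unit mul1r big1 ?add0r // => l _.
    by rewrite U0 ?mulr0 ?eqSS ?[i == _ :> nat]gtn_eqF // ltn_eqF // ltnS ltnW.
  move=> k; rewrite addn1 => ltk.
  by rewrite U0 ?[k == _]gtn_eqF // ltn_eqF // ltnW.
split; first exact: d_symmetric_symm S_def.
case: d d_ge1 A L A1_mops J1_banded A1_rec Lm_prod Lm_banded L_banded L_unit
  L_inv A_rec S_def hL => // d' _ A L _ _ A1_rec Lm_prod _ L_banded L_unit _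
  A_rec S_def hL.
apply: (typeII_mops_symm L_banded L_unit U_banded U_band1 _ S_def) => j.
have [->|j0] := eqVneq j ord0; last by apply: A_rec; rewrite lt0n.
(* The first family is governed by [J1], the transform of index 0: its trailing product is empty. *)
suff -> : darboux L U (ord0 : 'I_d'.+2) = J1 by [].
rewrite /darboux -Lm_prod big_pred0 // -J1_LU (semimx_mulr1 (b := 1)) //.
rewrite J1_LU Lm_prod.
exact: (unit_upper_band_mul (unit_upper_band_smprod xpredT hL) U_band1).
Qed.
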